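(* Let $\varphi(s)=s+c_1$ with $c_1\in\mathbb C$, $\mathrm{Re}(c_1)\ge0$. Then the composition operator $C_\varphi$ on $\mathcal H^2$ has the double commutant property.
   Context: $\mathcal H^2$ is the Hilbert space of Dirichlet series $f(s)=\sum_{n\ge1}a_nn^{-s}$ with $\|f\|=(\sum|a_n|^2)^{1/2}<\infty$ (analytic on $\{\mathrm{Re}\,s>1/2\}$), and $C_\varphi f=f\circ\varphi$. For a set $\mathcal A\subset\mathcal B(H)$ of bounded operators on a Hilbert space $H$, $\mathcal A'=\{T\in\mathcal B(H):TA=AT\ \text{for all }A\in\mathcal A\}$ and $\mathcal A''=(\mathcal A')'$. For $A\in\mathcal B(H)$, $\mathrm{alg}(A)=\{p(A):p\text{ a polynomial}\}$, and $A$ has the double commutant property if $\overline{\mathrm{alg}(A)}^{\sigma}=\{A\}''$, where $\sigma$ denotes the weak operator topology. *)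

(* Defs.v *)
From HB Require Import structures.
From mathcomp Require Import all_boot all_order all_algebra.
From mathcomp Require Import sesquilinear complex.
From mathcomp Require Import ring lra.
From mathcomp Require Import all_classical all_reals all_analysis.
Import Order.TTheory GRing.Theory Num.Theory numFieldNormedType.Exports.

Set Implicit Arguments.
Unset Strict Implicit.
Unset Printing Implicit Defensive.

Local Open Scope classical_set_scope.
Local Open Scope complex_scope.
Local Open Scope ring_scope.

(* [Re] and [Im] are the [R]-valued projections of [R[i]]; inner products are
   linear in the first argument and conjugate-linear in the second. *)
Local Notation Re := complex.Re.
Local Notation Im := complex.Im.

Definition dot_norm (R : realType) (H : lmodType R[i])
    (dot : {dot H for @conjc R}) (x : H) : R :=
  Num.sqrt (Re (dot x x)).

HB.mixin Record isHilbert (R : realType) H of GRing.Lmodule R[i] H := {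
  hdot : {dot H for @conjc R} ;
  hilbert_complete : forall u : nat -> H,
    (forall e : R, 0 < e -> exists N : nat, forall m n : nat,
      (N <= m)%N -> (N <= n)%N -> dot_norm hdot (u m - u n) < e) ->
    exists l : H, dot_norm hdot (u n - l) @[n --> \oo] --> (0 : R)
}.

#[short(type="hilbertType")]
HB.structure Definition Hilbert (R : realType) :=
  {H of isHilbert R H & GRing.Lmodule R[i] H}.

Definition hnorm (R : realType) (H : hilbertType R) (x : H) : R :=
  dot_norm hdot x.

Section BoundedOperators.
Context {R : realType} (H : hilbertType R).

Record bounded_op := BoundedOp {
  bop_linear :> {linear H -> H} ;
  bop_bounded : exists M : R, forall x : H,
    hnorm (bop_linear x) <= M * hnorm x
}.

HB.instance Definition _ := gen_eqMixin bounded_op.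
HB.instance Definition _ := gen_choiceMixin bounded_op.

Definition commutant (A : set bounded_op) : set bounded_op :=
  [set T | forall S, A S -> forall x, T (S x) = S (T x)].

(* The operators p(A) = \sum_i p_i A^i, p a complex polynomial. *)
Definition op_alg (A : bounded_op) : set bounded_op :=
  [set T | exists p : {poly R[i]}, forall x,
    T x = \sum_(i < size p) p`_i *: iter i A x].

Definition matrix_coef (T : bounded_op) : {ptws (H * H) -> R[i]^o} :=
  fun xy => hdot (T xy.1) xy.2.

(* The weak operator topology: the coarsest topology on the bounded operators
   for which all the maps T |-> <T x, y> are continuous. *)
Definition wot : Type := initial_topology matrix_coef.
HB.instance Definition _ := Topological.on wot.

Definition double_commutant_property (A : bounded_op) : Prop :=
  closure (op_alg A : set wot) = commutant (commutant [set A]).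

End BoundedOperators.

Section Series.
Context {R : realType}.
Implicit Types (a b : nat -> R[i]) (u : nat -> R[i]).

Definition csum u : R[i] := limn (series (u : (R[i]^o)^nat)).

Definition sqnorm (z : R[i]) : R := Re z ^+ 2 + Im z ^+ 2.

Definition sq_summable : {pred (nat -> R[i])} :=
  fun a => `[< cvgn (series (fun n => sqnorm (a n))) >].

Lemma sqnorm_ge0 z : 0 <= sqnorm z.
Proof. by rewrite addr_ge0 ?sqr_ge0. Qed.

Lemma sqnormE z : (sqnorm z)%:C = z * z^*.
Proof.
by case: z => x y; apply/eqP; rewrite eq_complex /sqnorm /=;
   apply/andP; split; apply/eqP; ring.
Qed.

Lemma sqnormD_le z w : sqnorm (z + w) <= 2 * sqnorm z + 2 * sqnorm w.
Proof. by case: z w => [x y] [x' y']; rewrite /sqnorm /=;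
   have := sqr_ge0 (x - x'); have := sqr_ge0 (y - y'); lra. Qed.

Lemma sqnormM z w : sqnorm (z * w) = sqnorm z * sqnorm w.
Proof. by case: z w => [x y] [x' y']; rewrite /sqnorm /=; ring. Qed.

Lemma sqnorm_gt0 z : z != 0 -> 0 < sqnorm z.
Proof.
move=> z0; rewrite lt_neqAle sqnorm_ge0 andbT eq_sym.
apply: contra z0; case: z => x y; rewrite /sqnorm paddr_eq0 ?sqr_ge0//=.
by rewrite !sqrf_eq0 => /andP[/eqP-> /eqP->].
Qed.


Lemma cvg_complex (u : nat -> R[i]) (x y : R) :
  (fun n => Re (u n)) @ \oo --> x -> (fun n => Im (u n)) @ \oo --> y ->
  (u : (R[i]^o)^nat) @ \oo --> (x +i* y : R[i]^o).
Proof.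
move=> ux uy; apply/cvgrPdist_lt => -[e e'] /=.
rewrite ltcE /= => /andP[/eqP he e0]; rewrite {}he {e'}.
have e20 : 0 < e / 2 by rewrite divr_gt0.
move/cvgrPdist_lt: ux => /(_ _ e20) ux; move/cvgrPdist_lt: uy => /(_ _ e20) uy.
near=> n.
have hx : `|x - Re (u n)| < e / 2 by near: n.
have hy : `|y - Im (u n)| < e / 2 by near: n.
rewrite normc_def ltcE /= eqxx /=.
move: hx hy; case: (u n) => a b /= hx hy.
rewrite -(ltr_pXn2r (n := 2)) ?nnegrE ?sqrtr_ge0 ?(ltW e0)//.
rewrite sqr_sqrtr ?addr_ge0 ?sqr_ge0// -(real_normK (num_real (x - a))) -(real_normK (num_real (y - b))).
move: (normr_ge0 (x - a)) (normr_ge0 (y - b)) => ? ?; nra.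
Unshelve. all: by end_near. Qed.

Lemma Re_sum u n : Re (series u n) = series (fun k => Re (u k)) n.
Proof. by rewrite !seriesEord /= (raddf_sum (@complex.Re R)). Qed.

Lemma Im_sum u n : Im (series u n) = series (fun k => Im (u k)) n.
Proof. by rewrite !seriesEord /= (raddf_sum (@complex.Im R)). Qed.

Lemma cvg_csum u : cvgn (series (fun k => Re (u k))) ->
  cvgn (series (fun k => Im (u k))) ->
  series (u : (R[i]^o)^nat) @ \oo -->
    (limn (series (fun k => Re (u k))) +i* limn (series (fun k => Im (u k)))
      : R[i]^o).
Proof.
move=> cr ci; apply: cvg_complex.
- by under eq_fun do rewrite Re_sum.
- by under eq_fun do rewrite Im_sum.
Qed.

Lemma csumE u : cvgn (series (fun k => Re (u k))) ->
  cvgn (series (fun k => Im (u k))) ->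
  csum u = limn (series (fun k => Re (u k))) +i* limn (series (fun k => Im (u k))).
Proof.
move=> cr ci; rewrite /csum; apply: (@cvg_lim (R[i]^o)) (cvg_csum cr ci).
exact: norm_hausdorff.
Qed.


Lemma sq_summableP a :
  reflect (cvgn (series (fun n => sqnorm (a n)))) (a \in sq_summable).
Proof. exact: asboolP. Qed.

Lemma sq_summable_submod : submod_closed sq_summable.
Proof.
split=> [|c a b /sq_summableP sa /sq_summableP sb]; apply/sq_summableP.
  rewrite (_ : series _ = cst 0); first exact: is_cvg_cst.
  apply/funext => n; rewrite seriesEord /= big1// => i _.
  by rewrite /sqnorm /= expr0n addr0.
apply: (@series_le_cvg _ _
    (2 * sqnorm c *: (fun n => sqnorm (a n)) + 2 *: (fun n => sqnorm (b n)))).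
- by move=> n; exact: sqnorm_ge0.
- move=> n /=; apply: addr_ge0.
    by rewrite !mulr_ge0 ?sqnorm_ge0.
  by rewrite mulr_ge0 ?sqnorm_ge0.
- move=> n; apply: le_trans (sqnormD_le _ _) _.
  by rewrite sqnormM mulrA.
- by apply: is_cvg_seriesD; exact: is_cvg_seriesZ.
Qed.

HB.instance Definition _ :=
  GRing.isSubmodClosed.Build R[i] (nat -> R[i]) sq_summable sq_summable_submod.

Lemma dot_summable a b : a \in sq_summable -> b \in sq_summable ->
  cvgn (series (fun k => Re (a k * (b k)^*))) /\
  cvgn (series (fun k => Im (a k * (b k)^*))).
Proof.
move=> /sq_summableP sa /sq_summableP sb.
have sab : cvgn (series ((fun n => sqnorm (a n)) + (fun n => sqnorm (b n)))).
  exact: is_cvg_seriesD.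
have dom (v : R^nat) : (forall n, `|v n| <= sqnorm (a n) + sqnorm (b n)) ->
    cvgn (series v).
  move=> le_v; apply: normed_cvg; apply: series_le_cvg sab => //= n.
  by rewrite addr_ge0 ?sqnorm_ge0.
split; apply: dom => n; case: (a n) (b n) => [x y] [x' y'];
  rewrite /sqnorm /= ler_norml; apply/andP;
  move: (sqr_ge0 (x - x')) (sqr_ge0 (x + x')) (sqr_ge0 (y - y'))
    (sqr_ge0 (y + y')) (sqr_ge0 (x - y')) (sqr_ge0 (x + y')) (sqr_ge0 (y - x'))
    (sqr_ge0 (y + x')) (sqr_ge0 x) (sqr_ge0 y) (sqr_ge0 x') (sqr_ge0 y');
  by split; lra.
Qed.

Definition l2dot a b : R[i] := csum (fun n => a n * (b n)^*).

Lemma cvg_l2dot a b : a \in sq_summable -> b \in sq_summable ->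
  series ((fun n => a n * (b n)^*) : (R[i]^o)^nat) @ \oo --> (l2dot a b : R[i]^o).
Proof.
by move=> sa sb; have [cr ci] := dot_summable sa sb;
   rewrite /l2dot csumE//; exact: cvg_csum.
Qed.

Lemma l2dot_linearl a b c k : a \in sq_summable -> b \in sq_summable ->
  c \in sq_summable -> l2dot (k *: a + b) c = k * l2dot a c + l2dot b c.
Proof.
move=> sa sb sc; rewrite /l2dot {1}/csum.
apply: (@cvg_lim (R[i]^o)); first exact: norm_hausdorff.
rewrite (_ : series _ = k *: series ((fun n => a n * (c n)^*) : (R[i]^o)^nat) +
    series ((fun n => b n * (c n)^*) : (R[i]^o)^nat)).
  apply: cvgD; last exact: cvg_l2dot.
  by apply: cvgZr; exact: cvg_l2dot.
rewrite -seriesZ -seriesD; congr series; apply/funext => n.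
by rewrite /= mulrDl -mulrA.
Qed.

Lemma l2dotC a b : a \in sq_summable -> b \in sq_summable ->
  l2dot a b = (l2dot b a)^*.
Proof.
move=> sa sb; have [cr ci] := dot_summable sa sb.
have [cr' ci'] := dot_summable sb sa.
rewrite /l2dot !csumE//=; congr (_ +i* _).
  congr (limn (series _)); apply/funext => n.
  by case: (a n) (b n) => [? ?] [? ?] /=; ring.
rewrite -lim_seriesN//; congr (limn (series _)); apply/funext => n.
transitivity (- Im (b n * (a n)^*)) => //.
by case: (a n) (b n) => [? ?] [? ?] /=; ring.
Qed.

Lemma l2dotE a : a \in sq_summable ->
  l2dot a a = (limn (series (fun n => sqnorm (a n))))%:C.
Proof.
move=> sa; have [cr ci] := dot_summable sa sa.
rewrite /l2dot csumE//; congr (_ +i* _).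
  by congr (limn (series _)); apply/funext => n; rewrite -sqnormE.
rewrite (_ : series _ = cst 0) ?lim_cst//.
apply/funext => n; rewrite seriesEord /= big1// => i _.
by rewrite -sqnormE.
Qed.

Lemma sqnorm_le_lim a n : a \in sq_summable ->
  series (fun n => sqnorm (a n)) n <= limn (series (fun n => sqnorm (a n))).
Proof.
move=> /sq_summableP sa; apply: nondecreasing_cvgn_le => //.
by apply: nondecreasing_series => k _ _; exact: sqnorm_ge0.
Qed.

End Series.

Arguments sq_summable {R}.

(* The element of H^2 with coefficients a : nat -> R[i] is the Dirichlet series
   \sum_(n >= 1) a_(n-1) n^-s: the coefficient of n^-s has index n - 1. *)
Record H2 (R : realType) := MkH2 {
  coef :> nat -> R[i] ;
  coef_sq_summable : coef \in sq_summable
}.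

Section H2.
Context {R : realType}.
Implicit Types f g : H2 R.

HB.instance Definition _ := [isSub for @coef R].
HB.instance Definition _ := [Choice of H2 R by <:].
HB.instance Definition _ := [SubChoice_isSubLmodule of H2 R by <:].

Definition H2_dot f g : R[i] := l2dot f g.

Lemma H2_dot_linearl g : linear_for *%R (H2_dot^~ g).
Proof.
by move=> k f f'; apply: l2dot_linearl; exact: coef_sq_summable.
Qed.

Lemma H2_dotC f g : H2_dot f g = (H2_dot g f)^*.
Proof. by apply: l2dotC; exact: coef_sq_summable. Qed.

Lemma H2_dot_linearr f : linear_for (@conjc R \; *%R) (H2_dot f).
Proof.
move=> k g g'; rewrite H2_dotC H2_dot_linearl rmorphD rmorphM /=.
by rewrite -!H2_dotC.
Qed.

HB.instance Definition _ := bilinear_isBilinear.Build R[i] (H2 R) (H2 R) R[i]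
  *%R (@conjc R \; *%R) H2_dot (H2_dot_linearl, H2_dot_linearr).

Lemma H2_dot_hermitian f g : H2_dot f g = (-1) ^+ false * (H2_dot g f)^*.
Proof. by rewrite mul1r -H2_dotC. Qed.

HB.instance Definition _ := isHermitianSesquilinear.Build R[i] (H2 R) false
  (@conjc R) H2_dot H2_dot_hermitian.

Lemma H2_dot_gt0 f : f != 0 -> 0 < H2_dot f f.
Proof.
move=> f0; rewrite /H2_dot l2dotE ?coef_sq_summable// ltcR.
have [n fn0] : exists n, coef f n != 0.
  apply: contrapT => /forallNP f00; move/negP: f0; apply.
  apply/eqP/val_inj/funext => n /=.
  by have /negP/negPn/eqP := f00 n.
apply: lt_le_trans (sqnorm_le_lim n.+1 (coef_sq_summable f)).
rewrite seriesSr ltr_wpDl ?sqnorm_gt0// seriesEord sumr_ge0// => i _.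
exact: sqnorm_ge0.
Qed.

HB.instance Definition _ := isDotProduct.Build R[i] (H2 R) H2_dot H2_dot_gt0.

Lemma H2_dot_normE f :
  dot_norm (@H2_dot : {dot H2 R for @conjc R}) f =
  Num.sqrt (limn (series (fun n => sqnorm (coef f n)))).
Proof. by rewrite /dot_norm /= /H2_dot l2dotE ?coef_sq_summable. Qed.

Lemma coefB f g n : coef (f - g) n = coef f n - coef g n.
Proof. by []. Qed.

Lemma H2_complete (u : nat -> H2 R) :
  (forall e : R, 0 < e -> exists N : nat, forall m n : nat,
    (N <= m)%N -> (N <= n)%N ->
    dot_norm (@H2_dot : {dot H2 R for @conjc R}) (u m - u n) < e) ->
  exists l : H2 R,
    dot_norm (@H2_dot : {dot H2 R for @conjc R}) (u n - l) @[n --> \oo] --> (0 : R).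
Proof.
move=> cu.
have cu' (e : R) : 0 < e -> exists N : nat, forall m n : nat,
    (N <= m)%N -> (N <= n)%N -> forall K,
    series (fun k => sqnorm (coef (u m) k - coef (u n) k)) K <= e ^+ 2.
  move=> e0; have [N cN] := cu _ e0; exists N => m n Nm Nn K.
  have := cN m n Nm Nn; rewrite H2_dot_normE => lt_e.
  apply: le_trans (sqnorm_le_lim K (coef_sq_summable (u m - u n))) _.
  set L := limn _ in lt_e *.
  have L0 : 0 <= L.
    apply: le_trans (sqnorm_le_lim 0 (coef_sq_summable (u m - u n))).
    by rewrite seriesEord /= big_ord0.
  by rewrite -[L]sqr_sqrtr// ler_pXn2r// ?nnegrE ?sqrtr_ge0 ?(ltW e0)// ltW.
have cauchy_part (h : R[i] -> R) (k : nat) :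
    (forall z w, `|h z - h w| ^+ 2 <= sqnorm (z - w)) ->
    cvgn (fun n => h (coef (u n) k)).
  move=> hle; apply/cauchy_cvgP/cauchy_exP => e /= e0.
  have e20 : 0 < e / 2 by rewrite divr_gt0.
  have [N cN] := cu' _ e20; exists (h (coef (u N) k)); exists N => // n /= Nn.
  rewrite /ball /=; apply: (@le_lt_trans _ _ (e / 2)); last first.
    by rewrite ltr_pdivrMr// ltr_pMr// ltr1n.
  rewrite -(ler_pXn2r (n := 2)) ?nnegrE// ?(ltW e20)//.
  apply: le_trans (hle _ _) _; apply: le_trans (cN N n (leqnn N) Nn k.+1).
  rewrite seriesSr lerDr seriesEord sumr_ge0// => i _; exact: sqnorm_ge0.
have cRe k : cvgn (fun n => Re (coef (u n) k)).
  apply: cauchy_part => -[x y] [x' y']; rewrite real_normK ?num_real//.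
  by rewrite /sqnorm /= lerDl sqr_ge0.
have cIm k : cvgn (fun n => Im (coef (u n) k)).
  apply: cauchy_part => -[x y] [x' y']; rewrite real_normK ?num_real//.
  by rewrite /sqnorm /= lerDr sqr_ge0.
pose l k := limn (fun n => Re (coef (u n) k)) +i* limn (fun n => Im (coef (u n) k)).
have le_l (e : R) : 0 < e -> exists N : nat, forall n : nat,
    (N <= n)%N -> forall K,
    series (fun k => sqnorm (coef (u n) k - l k)) K <= e ^+ 2.
  move=> e0; have [N cN] := cu' _ e0; exists N => n Nn K.
  have cvgK : (fun m => series (fun k => sqnorm (coef (u n) k - coef (u m) k)) K)
      @ \oo --> series (fun k => sqnorm (coef (u n) k - l k)) K.
    elim: K => [|K IH].
      under eq_fun do rewrite seriesEord /= big_ord0.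
      by rewrite seriesEord /= big_ord0; exact: cvg_cst.
    under eq_fun do rewrite seriesSr.
    rewrite seriesSr; apply: cvgD => //.
    have sqE (z w : R[i]) : sqnorm (z - w) =
        (Re z - Re w) * (Re z - Re w) + (Im z - Im w) * (Im z - Im w).
      by case: z w => [? ?] [? ?].
    under eq_fun do rewrite sqE.
    rewrite sqE; apply: cvgD; apply: cvgM; apply: cvgB;
      by [exact: cvg_cst | exact: cRe | exact: cIm].
  rewrite -(cvg_lim _ cvgK)//; apply: limr_le; first by apply/cvg_ex; eexists; exact: cvgK.
  by exists N => // m /= Nm; exact: cN.
have sumB n : (exists M, forall K,
    series (fun k => sqnorm (coef (u n) k - l k)) K <= M) ->
    (coef (u n) - l) \in sq_summable.
  move=> [M leM]; apply/sq_summableP; apply: nondecreasing_is_cvgn.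
    by apply: nondecreasing_series => k _ _; exact: sqnorm_ge0.
  by exists M => _ [K _ <-]; exact: leM.
have lsum : l \in sq_summable.
  have [N cN] := le_l 1 ltr01.
  rewrite (_ : l = coef (u N) - (coef (u N) - l)); last by rewrite subKr.
  apply: rpredB; first exact: coef_sq_summable.
  by apply: sumB; exists (1 ^+ 2); exact: cN.
exists (MkH2 lsum); apply/cvgrPdist_le => e e0.
have [N cN] := le_l e e0; exists N => // n /= Nn.
rewrite sub0r normrN H2_dot_normE ger0_norm ?sqrtr_ge0//.
rewrite -[leRHS]ger0_norm ?(ltW e0)// -sqrtr_sqr ler_wsqrtr//.
apply: limr_le; first by apply/sq_summableP; exact: coef_sq_summable.
by near=> K; exact: cN.
Unshelve. all: by end_near. Qed.

HB.instance Definition _ := isHilbert.Build R (H2 R) H2_complete.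

End H2.

Section CompositionOperators.
Context {R : realType}.

Definition cexp (z : R[i]) : R[i] :=
  (expR (Re z))%:C * (cos (Im z) +i* sin (Im z)).

Definition dirichlet_pow (n : nat) (s : R[i]) : R[i] :=
  cexp (- s * (ln n%:R)%:C).

(* The sum of the Dirichlet series f at s, an analytic function of s on
   the half-plane Re s > 1/2. *)
Definition H2_eval (f : H2 R) (s : R[i]) : R[i] :=
  csum (fun n => coef f n * dirichlet_pow n.+1 s).

Definition is_composition_op (phi : R[i] -> R[i]) (T : bounded_op (H2 R)) : Prop :=
  forall (f : H2 R) (s : R[i]), 2^-1 < Re s ->
    H2_eval (T f) s = H2_eval f (phi s).

End CompositionOperators.

(* Main.v *)
Require Import Defs.
From HB Require Import structures.
From mathcomp Require Import all_boot all_order all_algebra.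
From mathcomp Require Import sesquilinear complex.
From mathcomp Require Import ring lra.
From mathcomp Require Import all_classical all_reals all_analysis.
Import Order.TTheory GRing.Theory Num.Theory numFieldNormedType.Exports.
Local Open Scope classical_set_scope.
Local Open Scope complex_scope.
Local Open Scope ring_scope.

(** Translation by [c1] multiplies the coefficient of [(n+1)^-s] by
    [l n = (n+1)^-c1]. Hence the diagonal operator with eigenvalues [l n] is the
    composition operator, and it is the only one, because a Dirichlet series
    determines its coefficients ([H2_eval_inj]). The eigenvalues do not vanish,
    and their moduli [(n+1)^-(Re c1)] do not increase with [n]. Any diagonal
    operator [T] with these two properties has the double commutant property
    ([diag_double_commutant]).

    The double commutant of [T] consists of the diagonal operators whose
    eigenvalues [d n] depend on [l n] only, that is, [l m = l n] implies
    [d m = d n]. Operators in it commute with the matrix units that commute with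
    [T], which gives this form ([commutant2_diag]); the converse is a computation
    with matrix entries ([diag_commutant2]).

    Polynomials in [T] have this form, and so do their weak limits, because matrix
    entries are weakly continuous ([closure_op_alg_diag]). This is one inclusion.

    For the other one, weak convergence of diagonal operators follows from bounded
    pointwise convergence of their eigenvalues ([cvg_hdot_diag]). It remains to
    produce polynomials that are bounded on the eigenvalues and converge there to
    the indicator of one eigenvalue [l n]. Divide by [l n]: the remaining
    eigenvalues of modulus at most [|l n|] lie in the closed unit disc, where the
    Cesaro means of the powers of [z] are bounded and tend to the indicator of the
    point 1. The eigenvalues of larger modulus come earlier in the sequence, so
    there are finitely many of them and a polynomial factor annihilates them
    ([cvg_peak]). Linear combinations of these polynomials, followed by a second
    limit, reach every [d] ([diag_double_commutant]). *)

Set Implicit Arguments.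
Unset Strict Implicit.
Unset Printing Implicit Defensive.

Local Notation Re := complex.Re.
Local Notation Im := complex.Im.

(** * Moduli, real and imaginary parts *)

Section ComplexAbs.
Context {R : realType}.
Implicit Types z w : R[i].

Lemma normc_sqnorm z : `|z| = (Num.sqrt (sqnorm z))%:C.
Proof. by rewrite normc_def. Qed.

Lemma sqnorm_le z (B : R) : 0 <= B -> (`|z| <= B%:C) = (sqnorm z <= B ^+ 2).
Proof.
move=> B0; rewrite normc_sqnorm lecR -[in RHS](sqr_sqrtr (sqnorm_ge0 z)).
by rewrite ler_pXn2r// nnegrE sqrtr_ge0.
Qed.

Lemma ler_sqnorm z w : (`|z| <= `|w|) = (sqnorm z <= sqnorm w).
Proof. by rewrite !normc_sqnorm lecR ler_sqrt// sqnorm_ge0. Qed.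

Lemma normr_Re_le z (B : R) : `|z| <= B%:C -> `|Re z| <= B.
Proof. by move=> h; rewrite -lecR; apply: le_trans (normc_ge_Re z) h. Qed.

Lemma normr_Im_le z (B : R) : `|z| <= B%:C -> `|Im z| <= B.
Proof.
move=> h; rewrite -normrN -ReiNIm; apply: normr_Re_le.
by rewrite normrM (_ : `|'i%C| = 1) ?mulr1// normc_def /= expr0n add0r expr1n sqrtr1.
Qed.

Lemma cvg_Re (u : nat -> R[i]) (l : R[i]) :
  (u : (R[i]^o)^nat) @ \oo --> (l : R[i]^o) -> (fun n => Re (u n)) @ \oo --> Re l.
Proof.
move=> /cvgrPdist_le ul; apply/cvgrPdist_le => e e0.
have e0' : 0 < e%:C :> R[i] by rewrite ltcR.
have := ul _ e0'; apply: filterS => n /= h; rewrite -raddfB.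
exact: normr_Re_le.
Qed.

Lemma cvg_Im (u : nat -> R[i]) (l : R[i]) :
  (u : (R[i]^o)^nat) @ \oo --> (l : R[i]^o) -> (fun n => Im (u n)) @ \oo --> Im l.
Proof.
move=> /cvgrPdist_le ul; apply/cvgrPdist_le => e e0.
have e0' : 0 < e%:C :> R[i] by rewrite ltcR.
have := ul _ e0'; apply: filterS => n /= h; rewrite -raddfB.
exact: normr_Im_le.
Qed.

End ComplexAbs.

(** * Dominated convergence for series *)

Section DominatedSeries.
Context {R : realType}.

Lemma is_cvg_series_dominated (v w : R^nat) : cvgn (series w) ->
  (forall m, `|v m| <= w m) -> cvgn (series v).
Proof.
move=> cw vw; apply: normed_cvg; apply: series_le_cvg cw => //= m.
exact: le_trans (vw m).
Qed.

(** The tail of a series is controlled by that of a majorant, uniformly over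
    all the series with this majorant. *)
Lemma series_tail_le (c w : R^nat) (K : nat) : cvgn (series w) ->
  (forall m, `|c m| <= w m) ->
  `|limn (series c) - series c K| <= limn (series w) - series w K.
Proof.
move=> cw cle.
have w0 m : 0 <= w m by apply: le_trans (cle m).
have cc : cvgn (series c) by exact: is_cvg_series_dominated cw cle.
have ndw : nondecreasing_seq (series w) by exact: nondecreasing_series.
have h : (fun M => `|series c M - series c K|) @ \oo -->
    `|limn (series c) - series c K|.
  by apply: cvg_norm; apply: cvgB => //; exact: cvg_cst.
apply: (cvgr_to_le h); exists K => // M /= KM.
rewrite sub_series_geq//; apply: le_trans (ler_norm_sum _ _ _) _.
apply: (@le_trans _ _ (series w M - series w K)).
  by rewrite sub_series_geq//; apply: ler_sum => i _.
by rewrite lerD2r; apply: nondecreasing_cvgn_le.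
Qed.

(** Tannery's theorem. The head of the sum converges because it is finite, and
    the tails are uniformly small by [series_tail_le]. This gives the weak
    convergence of diagonal operators, the density of finite sums and the
    uniqueness of the coefficients of a Dirichlet series. *)
Lemma tannery (c : nat -> R^nat) (l w : R^nat) : cvgn (series w) ->
  (forall N m, `|c N m| <= w m) ->
  (forall m, (fun N => c N m) @ \oo --> l m) ->
  (fun N => limn (series (c N))) @ \oo --> limn (series l).
Proof.
move=> cw cle cl.
have lle m : `|l m| <= w m.
  by apply: (cvgr_to_le (cvg_norm (cl m))); apply: nearW => N; exact: cle.
apply/cvgrPdist_le => e e0.
have e30 : 0 < e / 3 by rewrite divr_gt0.
have [K _ hK] := (cvgrPdist_le _ _).1 cw _ e30.
have {}hK : `|limn (series w) - series w K| <= e / 3 := hK K (leqnn K).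
have cK : (fun N => series (c N) K) @ \oo --> series l K.
  elim: (K) => [|k IH].
    under eq_fun do rewrite seriesEord /= big_ord0.
    by rewrite seriesEord /= big_ord0; exact: cvg_cst.
  under eq_fun do rewrite seriesSr.
  by rewrite seriesSr; exact: cvgD.
have [N0 _ hN0] := (cvgrPdist_le _ _).1 cK _ e30.
exists N0 => // N /= /hN0 /= hN.
have tail (a : R^nat) : (forall m, `|a m| <= w m) ->
    `|limn (series a) - series a K| <= e / 3.
  move=> aw; apply: le_trans (series_tail_le K cw aw) _.
  exact: le_trans (ler_norm _) hK.
move: (tail _ lle) (tail _ (cle N)) hN; rewrite !ler_norml; lra.
Qed.

Lemma cvg_csum_dominated (u : nat -> R[i]) (w : R^nat) : cvgn (series w) ->
  (forall m, `|u m| <= (w m)%:C) ->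
  series (u : (R[i]^o)^nat) @ \oo --> (csum u : R[i]^o).
Proof.
move=> cw uw.
have cRe : cvgn (series (fun m => Re (u m))).
  by apply: (is_cvg_series_dominated cw) => m; exact: normr_Re_le.
have cIm : cvgn (series (fun m => Im (u m))).
  by apply: (is_cvg_series_dominated cw) => m; exact: normr_Im_le.
by rewrite csumE//; exact: cvg_csum.
Qed.

Lemma tannery_csum (u : nat -> nat -> R[i]) (l : nat -> R[i]) (w : R^nat) :
  cvgn (series w) -> (forall N m, `|u N m| <= (w m)%:C) ->
  (forall m, ((fun N => u N m) : (R[i]^o)^nat) @ \oo --> (l m : R[i]^o)) ->
  ((fun N => csum (u N)) : (R[i]^o)^nat) @ \oo --> (csum l : R[i]^o).
Proof.
move=> cw ule ul.
have dom v := @is_cvg_series_dominated v w cw.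
have cRe N m : `|Re (u N m)| <= w m by exact: normr_Re_le.
have cIm N m : `|Im (u N m)| <= w m by exact: normr_Im_le.
have lRe m : `|Re (l m)| <= w m.
  by apply: (cvgr_to_le (cvg_norm (cvg_Re (ul m)))); apply: nearW => N.
have lIm m : `|Im (l m)| <= w m.
  by apply: (cvgr_to_le (cvg_norm (cvg_Im (ul m)))); apply: nearW => N.
rewrite [csum l]csumE; [|exact: dom..].
have -> : (fun N => csum (u N)) = (fun N =>
    limn (series (fun k => Re (u N k))) +i* limn (series (fun k => Im (u N k)))).
  by apply/funext => N; rewrite csumE//; exact: dom.
apply: cvg_complex.
- by apply: (tannery cw) => // m; exact: cvg_Re.
- by apply: (tannery cw) => // m; exact: cvg_Im.
Qed.

End DominatedSeries.

(** * Norm and monomials in the space of Dirichlet series *)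

Section SquareSummable.
Context {R : realType}.
Implicit Types (f g : H2 R) (A B : bounded_op (H2 R)).

Lemma H2P f g : (forall n, coef f n = coef g n) -> f = g.
Proof. by move=> fg; apply/val_inj/funext. Qed.

Lemma H2_coefZ (a : R[i]) f n : coef (a *: f) n = a * coef f n.
Proof. by []. Qed.

Lemma H2_coef_sum (n : nat) (I : finType) (F : I -> H2 R) :
  coef (\sum_i F i) n = \sum_i coef (F i) n.
Proof. by elim/big_rec2: _ => // i y x _ <-. Qed.

Definition l2sum f : R := limn (series (fun n => sqnorm (coef f n))).

Lemma is_cvg_l2sum f : cvgn (series (fun n => sqnorm (coef f n))).
Proof. exact/sq_summableP/coef_sq_summable. Qed.
Arguments is_cvg_l2sum : clear implicits.

Lemma hnormE f : hnorm f = Num.sqrt (l2sum f).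
Proof. exact: H2_dot_normE. Qed.

Lemma hnorm_ge0 f : 0 <= hnorm f.
Proof. by rewrite hnormE sqrtr_ge0. Qed.

Lemma sqnorm_coef_le f n : sqnorm (coef f n) <= l2sum f.
Proof.
apply: le_trans (sqnorm_le_lim n.+1 (coef_sq_summable f)).
by rewrite seriesSr lerDr seriesEord sumr_ge0// => i _; exact: sqnorm_ge0.
Qed.

Lemma normr_coef_le f n : `|coef f n| <= (hnorm f)%:C.
Proof.
rewrite normc_sqnorm lecR hnormE ler_sqrt ?sqnorm_coef_le//.
by rewrite (le_trans _ (sqnorm_coef_le f n)) ?sqnorm_ge0.
Qed.

Lemma hnorm_le_scale f g (b : R) : 0 <= b ->
  (forall n, `|coef g n| <= b%:C * `|coef f n|) -> hnorm g <= b * hnorm f.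
Proof.
move=> b0 gf; rewrite !hnormE -[b]ger0_norm// -sqrtr_sqr -sqrtrM ?sqr_ge0//.
apply: ler_wsqrtr.
have -> : b ^+ 2 * l2sum f =
    limn (series (b ^+ 2 *: (fun n => sqnorm (coef f n)))).
  by rewrite lim_seriesZ//; exact: is_cvg_l2sum.
apply: lim_series_le; [exact: is_cvg_l2sum | |].
  by apply: is_cvg_seriesZ; exact: is_cvg_l2sum.
move=> n; rewrite -lecR -[leRHS]/((b ^+ 2 * sqnorm (coef f n))%:C).
rewrite rmorphM rmorphXn /= /sqnorm !add_Re2_Im2 -exprMn.
by rewrite ler_pXn2r// nnegrE// mulr_ge0// ler0c.
Qed.

Lemma monomial_summable (n : nat) :
  (fun k => (k == n)%:R : R[i]) \in sq_summable.
Proof.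
apply/sq_summableP; apply/cvg_ex; exists 1; apply: cvg_near_cst.
exists n.+1 => // K /= nK; rewrite seriesEord /= (bigD1 (Ordinal nK))//= big1.
  by rewrite eqxx /sqnorm /= expr1n expr0n !addr0.
by move=> i /negbTE; rewrite -val_eqE /= => ->; rewrite /sqnorm /= expr0n addr0.
Qed.

(** The Dirichlet monomial [(n+1)^-s]: the monomials are an orthonormal basis. *)
Definition monomial (n : nat) : H2 R := MkH2 (monomial_summable n).

Lemma csum_single (u : nat -> R[i]) (m : nat) :
  (forall k, k != m -> u k = 0) -> csum u = u m.
Proof.
move=> u0; apply: (@cvg_lim (R[i]^o)); first exact: norm_hausdorff.
apply: cvg_near_cst; exists m.+1 => // K /= mK.
rewrite seriesEord /= (bigD1 (Ordinal mK))//= big1 ?addr0// => i im.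
by rewrite u0// -(inj_eq val_inj).
Qed.

Lemma hdot_monomial f m : hdot f (monomial m) = coef f m.
Proof.
transitivity (l2dot (coef f) (coef (monomial m))) => //.
rewrite /l2dot (@csum_single _ m) /= ?eqxx ?rmorph1 ?mulr1//.
by move=> k /negbTE ->; rewrite rmorph0 mulr0.
Qed.

Lemma hnorm_monomial n : hnorm (monomial n) = 1.
Proof. by rewrite /hnorm /dot_norm hdot_monomial /= eqxx sqrtr1. Qed.

Lemma cvg_l2sum_trunc f :
  (fun K => l2sum (f - \sum_(i < K) coef f i *: monomial i)) @ \oo --> (0 : R).
Proof.
have tc K n : coef (f - \sum_(i < K) coef f i *: monomial i) n =
    if (n < K)%N then 0 else coef f n.
  rewrite Defs.coefB H2_coef_sum; case: (ssrnat.ltnP n K) => [nK|Kn].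
    rewrite (bigD1 (Ordinal nK))// big1.
      by rewrite H2_coefZ /= eqxx mulr1 addr0 subrr.
    move=> i /negbTE ni; rewrite -(inj_eq val_inj) eq_sym /= in ni.
    by rewrite H2_coefZ /= ni mulr0.
  rewrite big1 ?subr0// => i _.
  by rewrite H2_coefZ /= gtn_eqF ?mulr0// (leq_trans (ltn_ord i)).
have -> : (fun K => l2sum (f - \sum_(i < K) coef f i *: monomial i)) = (fun K =>
    limn (series (fun n => if (n < K)%N then 0 else sqnorm (coef f n)))).
  apply/funext => K; congr (limn (series _)); apply/funext => n.
  by rewrite tc; case: ifP => // _; rewrite /sqnorm /= expr0n addr0.
have lim0 : limn (series (cst 0 : R^nat)) = 0.
  rewrite (_ : series _ = cst 0) ?lim_cst//.
  by apply/funext => n; rewrite seriesEord /= big1.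
have := @tannery _ (fun K n => if (n < K)%N then 0 else sqnorm (coef f n))
  (cst 0) _ (is_cvg_l2sum f).
rewrite lim0; apply=> [K n|n].
  by case: ifP => _; rewrite ?normr0 ?ger0_norm ?sqnorm_ge0.
by apply: cvg_near_cst; exists n.+1 => // K /= ->.
Qed.

Lemma bounded_op_bound A : exists2 M : R, 0 <= M &
  forall f, hnorm (A f) <= M * hnorm f.
Proof.
have [M hM] := bop_bounded A; exists `|M| => // f.
apply: le_trans (hM f) _; by rewrite ler_wpM2r ?hnorm_ge0// ler_norm.
Qed.

(** Bounded operators are determined by their values on the monomials, whose
    linear span is dense. *)
Lemma bounded_op_ext A B : (forall n, A (monomial n) = B (monomial n)) -> A =1 B.
Proof.
move=> AB f; apply: H2P => n; apply/eqP; rewrite -subr_eq0.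
have [M M0 hM] := bounded_op_bound A; have [N N0 hN] := bounded_op_bound B.
pose r K := f - \sum_(i < K) coef f i *: monomial i.
have ABr K : A f - B f = A (r K) - B (r K).
  have rK : A (f - r K) = B (f - r K).
    by rewrite subKr !linear_sum; apply: eq_bigr => i _; rewrite !linearZ /= AB.
  rewrite -[in LHS](subrK (r K) f) (linearD A) (linearD B) rK.
  by rewrite [X in X - _]addrC addrKA.
rewrite -normr_le0 normc_sqnorm lecR.
have cr : (fun K => (M + N) * hnorm (r K)) @ \oo --> (0 : R).
  rewrite -(mulr0 (M + N)); apply: cvgMr; rewrite -sqrtr0.
  under eq_fun do rewrite hnormE.
  apply: continuous_cvg; first exact: sqrt_continuous.
  exact: cvg_l2sum_trunc.
apply: (cvgr_to_ge cr); apply: nearW => K.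
rewrite -lecR -normc_sqnorm -Defs.coefB (ABr K) Defs.coefB.
apply: le_trans (ler_normB _ _) _; rewrite mulrDl rmorphD /=.
by apply: lerD; apply: le_trans (normr_coef_le _ _) _; rewrite lecR.
Qed.

End SquareSummable.

(** * Diagonal operators and their commutants *)

Section DiagonalOperators.
Context {R : realType}.
Implicit Types (d : nat -> R[i]) (f g : H2 R).

Definition bounded_symbol d := exists B : R, forall n, `|d n| <= B%:C.

Lemma bounded_symbolP d : bounded_symbol d ->
  exists2 B : R, 0 <= B & forall n, `|d n| <= B%:C.
Proof. by case=> B dB; exists B => //; rewrite -ler0c (le_trans _ (dB 0%N)). Qed.

Lemma diag_summable d f : bounded_symbol d ->
  (fun n => d n * coef f n) \in sq_summable.
Proof.
case/bounded_symbolP => B B0 dB; apply/sq_summableP.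
apply: (@series_le_cvg _ _ (B ^+ 2 *: (fun n => sqnorm (coef f n)))).
- by move=> n; exact: sqnorm_ge0.
- by move=> n; rewrite mulr_ge0 ?sqr_ge0 ?sqnorm_ge0.
- by move=> n; rewrite sqnormM ler_wpM2r ?sqnorm_ge0// -sqnorm_le.
- by apply: is_cvg_seriesZ; exact: is_cvg_l2sum.
Qed.

Definition diag_fun d (hd : bounded_symbol d) f : H2 R := MkH2 (diag_summable f hd).

Lemma diag_fun_linear d (hd : bounded_symbol d) : linear (diag_fun hd).
Proof.
move=> a f g; apply: H2P => n.
rewrite -[LHS]/(d n * (a * coef f n + coef g n)).
rewrite -[RHS]/(a * (d n * coef f n) + d n * coef g n).
ring.
Qed.

HB.instance Definition _ d (hd : bounded_symbol d) :=
  GRing.isLinear.Build R[i] (H2 R) (H2 R) *:%R (diag_fun hd) (diag_fun_linear hd).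

Lemma diag_fun_bounded d (hd : bounded_symbol d) :
  exists M : R, forall f, hnorm (diag_fun hd f) <= M * hnorm f.
Proof.
have [B B0 dB] := bounded_symbolP hd; exists B => f.
by apply: hnorm_le_scale => // n; rewrite normrM ler_wpM2r.
Qed.

Definition diag d (hd : bounded_symbol d) : bounded_op (H2 R) :=
  @BoundedOp _ _ (diag_fun hd) (diag_fun_bounded hd).

Lemma diagE d (hd : bounded_symbol d) f n : coef (diag hd f) n = d n * coef f n.
Proof. by []. Qed.

Lemma diag_monomial d (hd : bounded_symbol d) n :
  diag hd (monomial n) = d n *: monomial n.
Proof.
apply: H2P => k; rewrite diagE H2_coefZ /=.
by case: eqP => [->|_]; rewrite ?mulr0.
Qed.

Definition rank1_fun (m n : nat) f : H2 R := coef f n *: monomial m.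

Lemma rank1_fun_linear m n : linear (rank1_fun m n).
Proof. by move=> a f g; rewrite /rank1_fun scalerA -scalerDl. Qed.

HB.instance Definition _ m n :=
  GRing.isLinear.Build R[i] (H2 R) (H2 R) *:%R (rank1_fun m n) (rank1_fun_linear m n).

Lemma rank1_fun_bounded m n :
  exists M : R, forall f, hnorm (rank1_fun m n f) <= M * hnorm f.
Proof.
exists (hnorm (monomial m : H2 R)) => f; rewrite mulrC.
apply: hnorm_le_scale; first exact: hnorm_ge0.
by move=> k; rewrite H2_coefZ normrM ler_wpM2r// normr_coef_le.
Qed.

(** The matrix unit that sends [monomial n] to [monomial m] and kills the other
    monomials. *)
Definition rank1 m n : bounded_op (H2 R) :=
  @BoundedOp _ _ (rank1_fun m n) (rank1_fun_bounded m n).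

Definition comp_fun (A B : bounded_op (H2 R)) f := A (B f).
Lemma comp_fun_linear A B : linear (comp_fun A B).
Proof. by move=> a f g; rewrite /comp_fun !linearP. Qed.
HB.instance Definition _ A B :=
  GRing.isLinear.Build R[i] (H2 R) (H2 R) *:%R (comp_fun A B) (comp_fun_linear A B).
Lemma comp_fun_bounded A B :
  exists M : R, forall f, hnorm (comp_fun A B f) <= M * hnorm f.
Proof.
have [M M0 hM] := bounded_op_bound A; have [N _ hN] := bounded_op_bound B.
exists (M * N) => f; apply: le_trans (hM _) _.
by rewrite -mulrA ler_wpM2l.
Qed.
Definition comp_op A B : bounded_op (H2 R) :=
  @BoundedOp _ _ (comp_fun A B) (comp_fun_bounded A B).


(** The eigenvalues are automatically bounded, so that the given operator can be
    compared with [diag d], with which it agrees on the monomials. *)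
Lemma diag_of_eigenbasis d (A : bounded_op (H2 R)) :
  (forall n, A (monomial n) = d n *: monomial n) ->
  bounded_symbol d /\ forall f n, coef (A f) n = d n * coef f n.
Proof.
move=> Ad; have dB : bounded_symbol d.
  have [M M0 hM] := bounded_op_bound A; exists M => n.
  have := normr_coef_le (A (monomial n)) n.
  rewrite Ad H2_coefZ /= eqxx mulr1 -Ad => /le_trans; apply.
  by rewrite lecR (le_trans (hM _))// hnorm_monomial mulr1.
split=> // f n; rewrite -[RHS](diagE dB); congr (coef _ n).
by apply: bounded_op_ext => k; rewrite diag_monomial Ad.
Qed.

Lemma eigenbasis_of_diag d (A : bounded_op (H2 R)) :
  (forall f n, coef (A f) n = d n * coef f n) ->
  forall n, A (monomial n) = d n *: monomial n.
Proof.
move=> Ad n; apply: H2P => k; rewrite Ad H2_coefZ /=.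
by case: eqP => [->|_]; rewrite ?mulr0.
Qed.

(** A diagonal operator commutes with the matrix unit [rank1 m n] as soon as its
    m-th and n-th eigenvalues agree. An operator that commutes with these matrix
    units is diagonal (take [m = n]), with eigenvalues that agree wherever those
    of [T] do. *)
Lemma commutant2_diag (l : nat -> R[i]) (T A : bounded_op (H2 R)) :
  (forall f n, coef (T f) n = l n * coef f n) ->
  commutant (commutant [set T]) A ->
  exists d, [/\ bounded_symbol d, (forall f n, coef (A f) n = d n * coef f n) &
    forall m n, l m = l n -> d m = d n].
Proof.
move=> Tl AT; pose d n := coef (A (monomial n)) n.
have Td := eigenbasis_of_diag Tl.
have key m n : l m = l n -> A (monomial m) = d n *: monomial m.
  move=> lmn.
  have Rmn : commutant [set T] (rank1 m n).
    move=> _ -> f; rewrite -[LHS]/(coef (T f) n *: monomial m).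
    rewrite -[rank1 m n f]/(coef f n *: monomial m).
    by rewrite Tl linearZ /= Td scalerA lmn mulrC.
  have := AT _ Rmn (monomial n).
  rewrite -[rank1 m n (monomial n)]/((n == n)%:R *: monomial m).
  by rewrite eqxx scale1r => ->.
have [dB Ad] := diag_of_eigenbasis (fun n => key n n erefl).
exists d; split=> // m n lmn.
by rewrite /d (key _ _ lmn) H2_coefZ /= eqxx mulr1.
Qed.

(** If [S] commutes with [T], its matrix entry at [(m, n)] vanishes unless
    [l m = l n]; and then [d m = d n] as well, so that [S] commutes with [A]. *)
Lemma diag_commutant2 (l d : nat -> R[i]) (T A : bounded_op (H2 R)) :
  (forall f n, coef (T f) n = l n * coef f n) ->
  (forall f n, coef (A f) n = d n * coef f n) ->
  (forall m n, l m = l n -> d m = d n) ->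
  commutant (commutant [set T]) A.
Proof.
move=> Tl Ad ld S ST.
suff : comp_op A S =1 comp_op S A by [].
apply: bounded_op_ext => n; rewrite -[LHS]/(A (S _)) -[RHS]/(S (A _)).
apply: H2P => m; rewrite Ad (eigenbasis_of_diag Ad) linearZ H2_coefZ /=.
have : l m * coef (S (monomial n)) m = l n * coef (S (monomial n)) m.
  rewrite -Tl -H2_coefZ -linearZ -(eigenbasis_of_diag Tl).
  by congr (coef _ m); exact/esym/ST.
case: (eqVneq (l m) (l n)) => [/ld -> //|lmn].
move/eqP; rewrite -subr_eq0 -mulrBl mulf_eq0 subr_eq0 (negbTE lmn) /= => /eqP ->.
by rewrite !mulr0.
Qed.

End DiagonalOperators.

(** * The weak operator topology *)

Lemma cvg_initial_topology (S : choiceType) (V : topologicalType) (f : S -> V)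
    (T : Type) (F : set_system T) (u : T -> S) (s : S) : Filter F ->
  f \o u @ F --> f s -> u @ F --> (s : initial_topology f).
Proof.
move=> FF fu U; rewrite nbhsE => -[W [[B Bo <-] Bs] WU].
have fuB : F ((f \o u) @^-1` B) by apply: fu; exact: open_nbhs_nbhs.
suff : F (u @^-1` U) by [].
by apply: filterS fuB => t Bt; exact: WU.
Qed.

Section WeakOperatorTopology.
Context {R : realType} (H : hilbertType R).
Implicit Types (x y : H).

Lemma wot_coef_continuous x y :
  continuous (fun A : wot H => hdot ((A : bounded_op H) x) y : R[i]^o).
Proof.
move=> A; apply: (@continuous_comp _ _ _ (@matrix_coef R H : wot H -> _)
  (@proj (H * H)%type (fun _ => R[i]^o) (x, y))).
  exact: initial_continuous.
exact: proj_continuous.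
Qed.

Lemma wot_cvg (u : nat -> bounded_op H) (A : bounded_op H) :
  (forall x y, ((fun N => hdot (u N x) y) : (R[i]^o)^nat) @ \oo -->
    (hdot (A x) y : R[i]^o)) ->
  (u : nat -> wot H) @ \oo --> (A : wot H).
Proof.
move=> uA; apply: cvg_initial_topology; apply/cvg_sup => -[x y].
by apply: cvg_initial_topology; exact: uA.
Qed.

Lemma closure_wot_cvg (C : set (bounded_op H)) (u : nat -> bounded_op H)
    (A : bounded_op H) :
  (forall N, closure (C : set (wot H)) (u N)) ->
  (forall x y, ((fun N => hdot (u N x) y) : (R[i]^o)^nat) @ \oo -->
    (hdot (A x) y : R[i]^o)) ->
  closure (C : set (wot H)) A.
Proof.
move=> Cu /wot_cvg uA; apply: (closed_cvg (closure (C : set (wot H)))) uA.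
  exact: closed_closure.
exact: nearW.
Qed.

(** A linear relation between matrix coefficients is a closed condition. *)
Lemma closure_wot_coef (C : set (bounded_op H)) (A : bounded_op H) x y x' y' (a b : R[i]):
  (forall S : bounded_op H, C S -> a * hdot (S x) y = b * hdot (S x') y') ->
  closure (C : set (wot H)) A -> a * hdot (A x) y = b * hdot (A x') y'.
Proof.
move=> CE CA; apply/eqP; rewrite -subr_eq0; apply/eqP.
pose h (S : wot H) : R[i]^o :=
  a * hdot ((S : bounded_op H) x) y - b * hdot ((S : bounded_op H) x') y'.
have hc : continuous h.
  have c t t' (k : R[i]) : continuous (fun S : wot H =>
      k *: (hdot ((S : bounded_op H) t) t' : R[i]^o) : R[i]^o).
    by move=> S; apply: cvgZr; [exact: nbhs_filter|exact: wot_coef_continuous].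
  by move=> S; apply: cvgB; [exact: nbhs_filter|exact: c|exact: c].
have /closure_id clh : closed (h @^-1` [set 0]).
  apply: (continuous_closedP h).1 => //.
  exact/accessible_closed_set1/hausdorff_accessible/norm_hausdorff.
suff : (h @^-1` [set 0]) A by [].
by rewrite clh; apply: closureS CA => S CS; rewrite /preimage/= /h CE// subrr.
Qed.

End WeakOperatorTopology.

(** * Polynomials that peak at one eigenvalue *)

Section PeakPolynomials.
Context {R : realType}.
Implicit Types (z : R[i]) (p : {poly R[i]}) (l : nat -> R[i]).

Lemma bounded_horner p (r : R) :
  exists B : R, forall z, `|z| <= r%:C -> `|p.[z]| <= B%:C.
Proof.
exists (Re (\sum_(i < size p) `|p`_i| * r%:C ^+ i)) => z zr.
have r0 : 0 <= r%:C by exact: le_trans zr.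
rewrite RRe_real; last first.
  by apply: ger0_real; apply: sumr_ge0 => i _; rewrite mulr_ge0// exprn_ge0.
rewrite horner_coef; apply: le_trans (ler_norm_sum _ _ _) _.
apply: ler_sum => i _; rewrite normrM normrX ler_wpM2l//.
by rewrite lerXn2r ?nnegrE.
Qed.

(** The Cesaro mean of the first powers: on the closed unit disc it is bounded
    by 1 and converges pointwise to the indicator function of the point 1. *)
Definition mean_poly N : {poly R[i]} :=
  (N.+1%:R)^-1 *: \sum_(k < N.+1) 'X^k.

Lemma horner_mean N z : (mean_poly N).[z] = (N.+1%:R)^-1 * \sum_(k < N.+1) z ^+ k.
Proof.
by rewrite hornerZ horner_sum; congr (_ * _); apply: eq_bigr => k _; rewrite hornerXn.
Qed.

Lemma mean_poly_le1 N z : `|z| <= 1 -> `|(mean_poly N).[z]| <= 1.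
Proof.
move=> z1; rewrite horner_mean normrM normfV normr_nat.
rewrite ler_pdivrMl ?ltr0n// mulr1; apply: le_trans (ler_norm_sum _ _ _) _.
have -> : N.+1%:R = \sum_(k < N.+1) (1 : R[i]) by rewrite sumr_const card_ord.
apply: ler_sum => k _.
by rewrite normrX exprn_ile1.
Qed.

Lemma cvg_harmonicC : ((fun N => (N.+1%:R)^-1) : (R[i]^o)^nat) @ \oo --> (0 : R[i]^o).
Proof.
have -> : (fun N => (N.+1%:R)^-1) = (fun N => (harmonic N)%:C) :> (nat -> R[i]).
  by apply/funext => N; rewrite /harmonic /= fmorphV rmorph_nat.
by apply: cvg_complex => /=; [exact: cvg_harmonic|exact: cvg_cst].
Qed.

Lemma cvg_mean_poly z : `|z| <= 1 ->
  ((fun N => (mean_poly N).[z]) : (R[i]^o)^nat) @ \oo --> ((z == 1)%:R : R[i]^o).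
Proof.
move=> z1; case: (eqVneq z 1) => [->|zN1].
  rewrite (_ : (fun N => _) = cst 1); first exact: cvg_cst.
  apply/funext => N; rewrite horner_mean (eq_bigr (fun=> 1)).
    by rewrite sumr_const card_ord mulVf// pnatr_eq0.
  by move=> k _; rewrite expr1n.
have z10 : z - 1 != 0 by rewrite subr_eq0.
(* the geometric sum bounds the mean at [z] by [2 / |z - 1| / (N + 1)] *)
have hc : ((fun N => (2 / `|z - 1|) *: ((N.+1%:R)^-1 : R[i]^o) : R[i]^o)
    @ \oo --> (0 : R[i]^o)).
  by rewrite -[X in _ --> X](scaler0 _ (2 / `|z - 1|)); apply: cvgZr; exact: cvg_harmonicC.
move/cvgrPdist_le: hc => hc; apply/cvgrPdist_le => e e0.
have [N0 _ hN] := hc e e0; exists N0 => // N /= /hN /= .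
apply: le_trans; rewrite !sub0r !normrN horner_mean.
have -> : \sum_(k < N.+1) z ^+ k = (z ^+ N.+1 - 1) / (z - 1).
  by rewrite subrX1 mulrC mulKf.
rewrite [leRHS]normrM [leLHS]normrM mulrC ler_wpM2r// normf_div normf_div.
rewrite normr_nat normr_id ler_wpM2r ?invr_ge0//.
apply: le_trans (ler_normB _ _) _; rewrite normr1 normrX.
by rewrite -[2]/(1 + 1) lerD2r exprn_ile1.
Qed.

(** The product interpolates 0 at the eigenvalues of index smaller than [n], whose
    moduli may exceed that of [l n]; at the other ones the argument [z / l n] of
    the mean stays in the unit disc. If [l n = l i] for some [i < n], the
    convention [0^-1 = 0] makes the whole polynomial vanish, so that each
    eigenvalue is counted only once, at the first index where it occurs. *)
Definition peak_poly l n N : {poly R[i]} :=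
  (\prod_(i < n) ((l n - l i)^-1 *: ('X - (l i)%:P))) *
  (mean_poly N \Po ((l n)^-1 *: 'X)).

Lemma horner_peak l n N z : (peak_poly l n N).[z] =
  (\prod_(i < n) ((l n - l i)^-1 * (z - l i))) * (mean_poly N).[(l n)^-1 * z].
Proof.
rewrite hornerM horner_prod horner_comp (hornerZ _ 'X) hornerX.
by congr (_ * _); apply: eq_bigr => i _; rewrite hornerZ hornerXsubC.
Qed.

Lemma peak_lt l n N m : (m < n)%N -> (peak_poly l n N).[l m] = 0.
Proof.
move=> mn; rewrite horner_peak (bigD1 (Ordinal mn))//= subrr mulr0 !mul0r.
by [].
Qed.

Section DecreasingModuli.
Context (l : nat -> R[i]) (l_neq0 : forall n, l n != 0)
  (l_decr : forall m n, (m <= n)%N -> `|l n| <= `|l m|).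

Lemma ratio_le1 m n : (n <= m)%N -> `|(l n)^-1 * l m| <= 1.
Proof.
move=> nm; rewrite normrM normfV ler_pdivrMl ?normr_gt0// mulr1.
exact: l_decr.
Qed.

Lemma peak_bound n : exists B : R, forall N m, `|(peak_poly l n N).[l m]| <= B%:C.
Proof.
pose q : {poly R[i]} := \prod_(i < n) ((l n - l i)^-1 *: ('X - (l i)%:P)).
have [B hB] := bounded_horner q (Num.sqrt (sqnorm (l 0%N))).
exists B => N m.
have qm : `|q.[l m]| <= B%:C by apply: hB; rewrite -normc_sqnorm l_decr.
case: (ssrnat.leqP n m) => [nm|mn]; last by rewrite peak_lt// normr0 (le_trans _ qm).
apply: le_trans qm; rewrite hornerM normrM ler_piMr// horner_comp (hornerZ _ 'X) hornerX.
exact/mean_poly_le1/ratio_le1.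
Qed.

Definition first_index m := ex_minn (ex_intro (fun i => l i == l m) m (eqxx (l m))).

Lemma l_first_index m : l (first_index m) = l m.
Proof. by rewrite /first_index; case: ex_minnP => i /eqP. Qed.

Lemma first_index_min m i : l i = l m -> (first_index m <= i)%N.
Proof. by move=> /eqP lim; rewrite /first_index; case: ex_minnP => j _; exact. Qed.

(** The three cases are [n < first_index m], where the mean tends to 0;
    [first_index m < n], where the product vanishes at [l m]; and equality, where
    both factors are 1. *)
Lemma cvg_peak n m : ((fun N => (peak_poly l n N).[l m]) : (R[i]^o)^nat) @ \oo -->
  ((n == first_index m)%:R : R[i]^o).
Proof.
have nm_leq : (first_index m <= m)%N by exact: first_index_min.
case: (ltngtP n (first_index m)) => [nf|fn|nf].
- have lnm : l n != l m.
    by apply/eqP => /first_index_min; rewrite leqNgt nf.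
  pose w := (l n)^-1 * l m; have wN1 : (w == 1) = false.
    apply/negbTE; apply: contra lnm => /eqP h.
    by rewrite -[l m](mulVKf (l_neq0 n)) -/w h mulr1.
  have w1 : `|w| <= 1 by exact: ratio_le1 (leq_trans (ltnW nf) nm_leq).
  pose c := \prod_(i < n) ((l n - l i)^-1 * (l m - l i)).
  have : ((fun N => c *: ((mean_poly N).[w] : R[i]^o) : R[i]^o) @ \oo -->
      (0 : R[i]^o)).
    rewrite -[X in _ --> X](scaler0 _ c); apply: cvgZr.
    by have := cvg_mean_poly w1; rewrite wN1.
  suff -> : (fun N => (peak_poly l n N).[l m]) = (fun N => c * (mean_poly N).[w]) by [].
  by apply/funext => N; rewrite horner_peak.
- rewrite (_ : (fun N => _) = cst 0); first exact: cvg_cst.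
  apply/funext => N; rewrite -l_first_index peak_lt//.
- have lnm : l n = l m by rewrite nf l_first_index.
  rewrite (_ : (fun N => _) = fun N => (mean_poly N).[1]).
    have := @cvg_mean_poly 1; rewrite eqxx normr1; exact.
  apply/funext => N; rewrite horner_peak -lnm mulVf// big1 ?mul1r// => i _.
  rewrite mulVf// subr_eq0; apply/eqP; rewrite lnm => /esym/first_index_min.
  by rewrite -nf leqNgt ltn_ord.
Qed.

End DecreasingModuli.
End PeakPolynomials.

(** * The double commutant property of diagonal operators *)

Section DiagonalDoubleCommutant.
Context {R : realType}.
Implicit Types (d l : nat -> R[i]) (f g : H2 R) (T A : bounded_op (H2 R)).

Lemma hdotE f g : hdot f g = csum (fun n => coef f n * (coef g n)^*).
Proof. by []. Qed.

(** Bounded pointwise convergence of the eigenvalues implies weak convergence of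
    the diagonal operators, by dominated convergence. *)
Lemma cvg_hdot_diag (u : nat -> bounded_op (H2 R)) A (dN : nat -> nat -> R[i]) d
    (B : R) f g :
  (forall N h n, coef (u N h) n = dN N n * coef h n) ->
  (forall h n, coef (A h) n = d n * coef h n) ->
  (forall N n, `|dN N n| <= B%:C) ->
  (forall n, ((fun N => dN N n) : (R[i]^o)^nat) @ \oo --> (d n : R[i]^o)) ->
  ((fun N => hdot (u N f) g) : (R[i]^o)^nat) @ \oo --> (hdot (A f) g : R[i]^o).
Proof.
move=> ud Ad dB dd; rewrite hdotE.
pose w : R^nat := fun n => B * (sqnorm (coef f n) + sqnorm (coef g n)).
have cw : cvgn (series w).
  have -> : w = B *: ((fun n => sqnorm (coef f n)) + (fun n => sqnorm (coef g n))).
    by [].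
  by apply: is_cvg_seriesZ; apply: is_cvg_seriesD; exact: is_cvg_l2sum.
have -> : (fun N => hdot (u N f) g) =
    (fun N => csum (fun n => dN N n * (coef f n * (coef g n)^*))).
  apply/funext => N; rewrite hdotE; congr csum; apply/funext => n.
  by rewrite ud mulrA.
have -> : (fun n => coef (A f) n * (coef g n)^*) =
    (fun n => d n * (coef f n * (coef g n)^*)).
  by apply/funext => n; rewrite Ad mulrA.
apply: (tannery_csum cw) => [N n|n].
  have := dB N n; rewrite normrM normrM normcJ !normc_sqnorm -!rmorphM !lecR /w.
  rewrite -{2}(sqr_sqrtr (sqnorm_ge0 (coef f n))).
  rewrite -{2}(sqr_sqrtr (sqnorm_ge0 (coef g n))).
  move: (sqrtr_ge0 (sqnorm (dN N n))) (sqrtr_ge0 (sqnorm (coef f n))).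
  move: (sqrtr_ge0 (sqnorm (coef g n))); do 3!move: (Num.sqrt _).
  move=> r s t t0 s0 r0 rB.
  apply: ler_pM => //; first exact: mulr_ge0.
  by have := sqr_ge0 (s - t); nra.
set c := coef f n * _; rewrite [d n * c]mulrC.
have -> : (fun N => dN N n * c) = (fun N => c *: (dN N n : R[i]^o)).
  by apply/funext => N; rewrite mulrC.
by apply: cvgZr; exact: dd.
Qed.

Lemma diag_iter l T f n i : (forall h m, coef (T h) m = l m * coef h m) ->
  coef (iter i T f) n = l n ^+ i * coef f n.
Proof.
by move=> Tl; elim: i => [|i IH]; rewrite ?mul1r//= Tl IH exprS mulrA.
Qed.

Lemma diag_op_poly l T (p : {poly R[i]}) f n :
  (forall h m, coef (T h) m = l m * coef h m) ->
  coef (\sum_(i < size p) p`_i *: iter i T f) n = p.[l n] * coef f n.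
Proof.
move=> Tl; rewrite H2_coef_sum horner_coef mulr_suml; apply: eq_bigr => i _.
by rewrite H2_coefZ (diag_iter _ _ _ Tl) mulrA.
Qed.

Lemma op_alg_diag l T (p : {poly R[i]}) A :
  (forall h m, coef (T h) m = l m * coef h m) ->
  (forall h m, coef (A h) m = p.[l m] * coef h m) -> op_alg T A.
Proof. by move=> Tl Ap; exists p => f; apply: H2P => n; rewrite (diag_op_poly _ _ _ Tl). Qed.

(** Vanishing off the diagonal and equality of two diagonal entries are linear
    relations between matrix coefficients. They hold for the polynomials in [T],
    hence on the closure. *)
Lemma closure_op_alg_diag l T A :
  (forall h m, coef (T h) m = l m * coef h m) ->
  closure (op_alg T : set (wot (H2 R))) A ->
  exists d, (forall h n, coef (A h) n = d n * coef h n) /\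
    forall m n, l m = l n -> d m = d n.
Proof.
move=> Tl clA.
have Sp S : op_alg T S -> exists p : {poly R[i]}, forall h m,
    coef (S h) m = p.[l m] * coef h m.
  by case=> p Sp; exists p => h m; rewrite Sp (diag_op_poly _ _ _ Tl).
have entry m n : m != n -> coef (A (monomial n)) m = 0.
  move=> /negbTE mn.
  have := closure_wot_coef (x := monomial n) (y := monomial m)
    (x' := monomial n) (y' := monomial m) (a := 1) (b := 0) _ clA.
  rewrite !hdot_monomial mul1r mul0r; apply => S /Sp[p Sd].
  by rewrite !hdot_monomial Sd /= mn mulr0 mulr0 mul0r.
pose d n := coef (A (monomial n)) n.
have Ad n : A (monomial n) = d n *: monomial n.
  apply: H2P => k; rewrite H2_coefZ /=.
  by case: (eqVneq k n) => [->|/entry ->]; rewrite ?mulr1 ?mulr0.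
exists d; split; first by have [] := diag_of_eigenbasis Ad.
move=> m n lmn.
have := closure_wot_coef (x := monomial m) (y := monomial m)
  (x' := monomial n) (y' := monomial n) (a := 1) (b := 1) _ clA.
rewrite !hdot_monomial !mul1r; apply => S /Sp[p Sd].
by rewrite !hdot_monomial !Sd /= !eqxx lmn.
Qed.

(** For the inclusion of the double commutant in the closure, let [A] be diagonal
    with eigenvalues [d]. The combination [P K N] of peak polynomials converges
    as [N] grows, boundedly and pointwise on the eigenvalues of [T], to the
    truncation [dK K] of [d] to the indices whose eigenvalue occurs before [K];
    and [dK K] converges to [d] in the same way as [K] grows. *)
Theorem diag_double_commutant l T :
  (forall f n, coef (T f) n = l n * coef f n) ->
  (forall n, l n != 0) ->
  (forall m n, (m <= n)%N -> `|l n| <= `|l m|) ->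
  double_commutant_property T.
Proof.
move=> Tl l0 ldec; apply/seteqP; split=> A.
  by move=> /(closure_op_alg_diag Tl)[d [Ad ld]]; exact: (diag_commutant2 Tl Ad).
move=> /(commutant2_diag Tl)[d [dB Ad ld]].
have [D D0 hD] := bounded_symbolP dB.
have [b hb] := choice (peak_bound l0 ldec).
have bl p : bounded_symbol (fun m => p.[l m]).
  have [B hB] := bounded_horner p (Num.sqrt (sqnorm (l 0%N))).
  by exists B => m; apply: hB; rewrite -normc_sqnorm ldec.
pose P K N : {poly R[i]} := \sum_(n < K) d n *: peak_poly l n N.
pose dK K m := if (first_index l m < K)%N then d m else 0.
have dKB K : bounded_symbol (dK K).
  by exists D => m; rewrite /dK; case: ifP => _; rewrite ?normr0 ?ler0c.
have clK K : closure (op_alg T : set (wot (H2 R))) (diag (dKB K)).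
  apply: (@closure_wot_cvg _ _ _ (fun N => diag (bl (P K N)))) => [N|f g].
    by apply: subset_closure; apply: (op_alg_diag (p := P K N) Tl) => h m; rewrite diagE.
  apply: (cvg_hdot_diag (dN := fun N m => (P K N).[l m]) (d := dK K)
    (B := \sum_(n < K) D * b n)) => // [N m|m].
    rewrite horner_sum rmorph_sum /=; apply: le_trans (ler_norm_sum _ _ _) _.
    apply: ler_sum => n _; rewrite hornerZ normrM rmorphM /=.
    by rewrite ler_pM.
  have -> : dK K m = \sum_(n < K) d n * (n == first_index l m :> nat)%:R.
    rewrite /dK; case: (ssrnat.ltnP (first_index l m) K) => [mK|Km].
      rewrite (bigD1 (Ordinal mK))//= eqxx mulr1 big1 ?addr0.
        by apply: ld; rewrite l_first_index.
      by move=> n; rewrite -(inj_eq val_inj) /= => /negbTE ->; rewrite mulr0.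
    rewrite big1// => n _; rewrite ltn_eqF ?mulr0//.
    exact: leq_trans (ltn_ord n) Km.
  rewrite /P.
  elim: (K) => [|k IH].
    rewrite big_ord0; apply: cvg_near_cst; near=> N.
    by rewrite big_ord0 horner0.
  rewrite big_ord_recr /=.
  have -> : (fun N => (\sum_(n < k.+1) d n *: peak_poly l n N).[l m]) = (fun N =>
    (\sum_(n < k) d n *: peak_poly l n N).[l m] + d k * (peak_poly l k N).[l m]).
    by apply/funext => N; rewrite big_ord_recr /= hornerD hornerZ.
  by apply: cvgD; [exact: IH|apply: cvgZr; exact: (cvg_peak l0 ldec)].
apply: (@closure_wot_cvg _ _ _ (fun K => diag (dKB K))) => // f g.
apply: (cvg_hdot_diag (dN := dK) (d := d) (B := D)) => //.
  by move=> K m; rewrite /dK; case: ifP => _; rewrite ?normr0 ?ler0c.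
move=> m; apply: cvg_near_cst; exists (first_index l m).+1 => // K /= mK.
by rewrite /dK mK.
Unshelve. all: by end_near. Qed.

End DiagonalDoubleCommutant.

(** * Dirichlet series and uniqueness of their coefficients *)

Section DirichletSeries.
Context {R : realType}.
Implicit Types (s z w : R[i]) (f g : H2 R).

Lemma cexpD z w : cexp (z + w) = cexp z * cexp w.
Proof.
case: z w => [a b] [c d]; rewrite /cexp /= expRD cosD sinD.
by apply/eqP; rewrite eq_complex /=; apply/andP; split; apply/eqP; ring.
Qed.

Lemma sqnorm_cexp z : sqnorm (cexp z) = expR (Re z) ^+ 2.
Proof.
rewrite /cexp sqnormM /sqnorm /= cos2Dsin2 expr0n addr0 mulr1.
by [].
Qed.

Lemma dirichlet_powD n s z :
  dirichlet_pow n (s + z) = dirichlet_pow n s * dirichlet_pow n z.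
Proof. by rewrite /dirichlet_pow -cexpD opprD mulrDl. Qed.

Lemma dirichlet_pow_nat n k :
  dirichlet_pow n.+1 (k%:R : R[i]) = ((n.+1%:R^-1 ^+ k : R)%:C).
Proof.
elim: k => [|k IH].
  rewrite /dirichlet_pow oppr0 mul0r /cexp /= expR0 cos0 sin0 expr0.
  by rewrite mul1r.
rewrite -[k.+1]addn1 natrD dirichlet_powD IH exprD rmorphM; congr (_ * _).
rewrite expr1 /dirichlet_pow /cexp /=.
have -> : - 1%:R * ln n.+1%:R - - 0 * 0 = - ln (n.+1%:R) :> R by ring.
have -> : - 1%:R * 0 + - 0 * ln n.+1%:R = 0 :> R by ring.
rewrite cos0 sin0 expRN lnK ?posrE//.
by rewrite -[RHS]mulr1.
Qed.

Lemma sqnorm_dirichlet_pow n s :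
  sqnorm (dirichlet_pow n s) = expR (- (Re s * ln n%:R)) ^+ 2.
Proof.
rewrite sqnorm_cexp; congr (expR _ ^+ 2); case: s => a b /=; ring.
Qed.

Lemma dirichlet_pow_neq0 n s : dirichlet_pow n s != 0 :> R[i].
Proof.
apply/eqP => h; have := sqnorm_dirichlet_pow n s.
rewrite h /sqnorm /= expr0n addr0 => /esym/eqP.
by rewrite expf_eq0 /= gt_eqF// expR_gt0.
Qed.

Lemma dirichlet_pow_decr s m n : 0 <= Re s -> (m <= n)%N ->
  `|dirichlet_pow n.+1 s| <= `|dirichlet_pow m.+1 s|.
Proof.
move=> s0 mn; rewrite ler_sqnorm !sqnorm_dirichlet_pow.
rewrite ler_pXn2r ?nnegrE ?expR_ge0// ler_expR lerN2 ler_wpM2l//.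
by rewrite ler_ln ?posrE ?ltr0n// ler_nat.
Qed.

(** [1 / (m+1)^2 <= 2 / ((m+1) (m+2))], which is the general term of a telescoping
    series. *)
Lemma is_cvg_inv_square : cvgn (series (fun m => (m.+1%:R ^- 2 : R))).
Proof.
apply: (@series_le_cvg _ _ (telescope (fun m => - 2 * harmonic m))).
- by move=> m; rewrite invr_ge0 exprn_ge0.
- move=> m; rewrite /telescope /= !mulNr opprK addrC subr_ge0 ler_wpM2l//.
  by rewrite lef_pV2 ?posrE// ler_nat.
- move=> m; rewrite /telescope /=.
  have m0 : 0 < m.+1%:R :> R by []. have m1 : 0 < m.+2%:R :> R by [].
  have -> : - 2 / m.+2%:R - - 2 / m.+1%:R = 2 / (m.+1%:R * m.+2%:R) :> R.
    rewrite -[m.+2%:R]natr1; field.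
    by rewrite [1 + m%:R]addrC !natr1 !gt_eqF.
  rewrite ler_pdivlMr ?mulr_gt0// mulrC ler_pdivrMr ?exprn_gt0//.
  rewrite -[m.+2%:R]natr1. have : 1 <= m.+1%:R :> R by rewrite ler1n. nra.
rewrite telescopeK; apply: is_cvgB; last exact: is_cvg_cst.
by apply: is_cvgMr; apply/cvg_ex; exists 0; exact: cvg_harmonic.
Qed.

Lemma csumZ (c : R[i]) (u : nat -> R[i]) (w : R^nat) : cvgn (series w) ->
  (forall m, `|u m| <= (w m)%:C) -> csum (fun m => c * u m) = c * csum u.
Proof.
move=> cw uw; apply: (@cvg_lim (R[i]^o)); first exact: norm_hausdorff.
rewrite (_ : series _ = c *: series (u : (R[i]^o)^nat)) -?seriesZ//.
by rewrite seriesZ; apply: cvgZr; exact: cvg_csum_dominated cw uw.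
Qed.

Lemma normrM_real_le z (x y b : R) : `|z| <= b%:C -> 0 <= x -> x <= y ->
  `|z * x%:C| <= (b * y)%:C.
Proof.
move=> zb x0 xy; rewrite normrM [X in _ <= X](rmorphM (real_complex R)) /=.
by apply: ler_pM => //; rewrite ger0_norm ?ler0c// lecR.
Qed.

(** At integers [s >= 2] the Dirichlet series of [f] is dominated by a multiple of
    the series of inverse squares. *)
Lemma H2_eval_dominated f k m :
  `|coef f m * dirichlet_pow m.+1 k.+2%:R| <=
  ((hnorm f *: (fun m => m.+1%:R ^- 2) : R^nat) m)%:C.
Proof.
rewrite dirichlet_pow_nat; apply: normrM_real_le.
- exact: normr_coef_le.
- by rewrite exprn_ge0.
- by rewrite -exprVn ler_wiXn2l// ?invr_ge0// invf_le1// ler1n.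
Qed.

Lemma is_cvg_dominator f :
  cvgn (series (hnorm f *: (fun m => m.+1%:R ^- 2) : R^nat)).
Proof. by apply: is_cvg_seriesZ; exact: is_cvg_inv_square. Qed.

Lemma H2_evalB f g k :
  H2_eval (f - g) k.+2%:R = H2_eval f k.+2%:R - H2_eval g k.+2%:R.
Proof.
apply: (@cvg_lim (R[i]^o)); first exact: norm_hausdorff.
have c h := cvg_csum_dominated (@is_cvg_dominator h) (H2_eval_dominated h k).
pose t h : (R[i]^o)^nat := fun m => coef h m * dirichlet_pow m.+1 k.+2%:R.
have -> : series (t (f - g)) = series (t f) - series (t g).
  rewrite -seriesN -seriesD; congr series; apply/funext => m.
  by rewrite /t Defs.coefB mulrBl.
by apply: cvgB; exact: c.
Qed.

(** If the coefficients of index smaller than [n] vanish, multiply the sum at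
    [s = k + 2] by [(n+1)^s] and let [k] grow: every term but the n-th tends to 0,
    which leaves the n-th coefficient as the limit of a null sequence. *)
Lemma H2_eval_eq0 f : (forall k, H2_eval f k.+2%:R = 0) -> f = 0.
Proof.
move=> f0; apply: H2P => n; rewrite -[RHS]/(0 : R[i]).
elim/ltn_ind: n => n IH.
pose B := hnorm f.
have csum0 k : csum (fun m => coef f m * ((n.+1%:R / m.+1%:R) ^+ k.+2 : R)%:C) = 0.
  have B0 : 0 <= B by exact: hnorm_ge0.
  pose u m := coef f m * dirichlet_pow m.+1 (k.+2%:R : R[i]).
  transitivity (csum (fun m => (n.+1%:R ^+ k.+2 : R)%:C * u m)).
    congr csum; apply/funext => m; rewrite /u dirichlet_pow_nat mulrCA -rmorphM.
    by rewrite -exprMn.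
  rewrite (csumZ _ (@is_cvg_dominator f) (H2_eval_dominated f k)).
  by rewrite -/(H2_eval f k.+2%:R) f0 mulr0.
pose rho m : R := n.+1%:R / m.+1%:R.
have rho0 m : 0 <= rho m by rewrite divr_ge0.
have rho1 m : (n <= m)%N -> rho m <= 1.
  by move=> nm; rewrite ler_pdivrMr// mul1r ler_nat.
pose w : R^nat := B * n.+1%:R ^+ 2 *: (fun m => m.+1%:R ^- 2).
have cw : cvgn (series w) by apply: is_cvg_seriesZ; exact: is_cvg_inv_square.
have : ((fun k => csum (fun m => coef f m * (rho m ^+ k.+2)%:C)) : (R[i]^o)^nat)
    @ \oo --> (csum (fun m => if m == n then coef f n else 0) : R[i]^o).
  apply: (tannery_csum cw) => [k m|m].
    rewrite -[leRHS]/((B * n.+1%:R ^+ 2 * m.+1%:R ^- 2)%:C) -mulrA.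
    case: (ssrnat.ltnP m n) => [mn|nm].
      rewrite IH// mul0r normr0 ler0c !mulr_ge0 ?invr_ge0 ?exprn_ge0//.
      exact: hnorm_ge0.
    apply: normrM_real_le; rewrite ?exprn_ge0 ?normr_coef_le//.
    rewrite -expr_div_n -/(rho m) -addn2 exprD ler_piMl ?exprn_ge0//.
    by rewrite exprn_ile1 ?rho1.
  case: (ltngtP m n) => [mn|nm|->].
  - rewrite (_ : (fun k => _) = cst 0); first exact: cvg_cst.
    by apply/funext => k; rewrite IH// mul0r.
  - have rlt1 : `|rho m| < 1.
      by rewrite ger0_norm// ltr_pdivrMr// mul1r ltr_nat.
    rewrite -[X in _ --> X](scaler0 _ (coef f m)).
    apply: cvgZr; apply: cvg_complex => /=; last exact: cvg_cst.
    by have := @cvg_expr _ _ rlt1; rewrite -(cvg_shiftn 2); under eq_fun do rewrite addn2.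
  - rewrite (_ : (fun k => _) = cst (coef f n)); first exact: cvg_cst.
    by apply/funext => k; rewrite /rho divff ?pnatr_eq0// expr1n mulr1.
rewrite (_ : (fun k => _) = cst 0); last exact/funext.
rewrite (@csum_single _ _ n) ?eqxx; last by move=> m /negbTE ->.
by move/(cvg_unique (@norm_hausdorff _ (R[i]^o))); apply; exact: cvg_cst.
Qed.

Lemma H2_eval_inj f g :
  (forall s, 2^-1 < Re s -> H2_eval f s = H2_eval g s) -> f = g.
Proof.
move=> fg; apply/eqP; rewrite -subr_eq0; apply/eqP; apply: H2_eval_eq0 => k.
rewrite H2_evalB fg ?subrr// -(rmorph_nat (real_complex R)) /=.
by apply: lt_le_trans (_ : 1 <= _); rewrite ?invf_lt1 ?ltr1n ?ler1n.
Qed.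

End DirichletSeries.

(** * Translations *)

Section Translation.
Context {R : realType}.

(** Translation by [c] multiplies the coefficient of [(n+1)^-s] by [(n+1)^-c], of
    modulus [(n+1)^-(Re c)]. *)
Lemma translation_eigen_bounded (c : R[i]) : 0 <= Re c ->
  bounded_symbol (fun n => dirichlet_pow n.+1 c).
Proof.
move=> c0; exists (Num.sqrt (sqnorm (dirichlet_pow 1 c))) => n.
by rewrite -normc_sqnorm dirichlet_pow_decr.
Qed.

Lemma H2_eval_diag (c : R[i]) (hc : bounded_symbol (fun n => dirichlet_pow n.+1 c))
  f s : H2_eval (diag hc f) s = H2_eval f (s + c).
Proof.
congr csum; apply/funext => n.
by rewrite diagE dirichlet_powD -mulrA mulrC -mulrA.
Qed.

End Translation.

Theorem corollary9p3 (R : realType) (c1 : R[i]) (hc1 : 0 <= complex.Re c1) :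
  (exists T : bounded_op (H2 R), is_composition_op (fun s => s + c1) T) /\
  (forall T : bounded_op (H2 R), is_composition_op (fun s => s + c1) T ->
    double_commutant_property T).
Proof.
have hc := translation_eigen_bounded hc1; split.
  by exists (diag hc) => f s _; exact: H2_eval_diag.
move=> T hT.
apply: (@diag_double_commutant _ (fun n => dirichlet_pow n.+1 c1)).
- move=> f n; rewrite -(diagE hc); congr (coef _ n).
  apply: H2_eval_inj => s s12; by rewrite hT// H2_eval_diag.
- by move=> n; exact: dirichlet_pow_neq0.
- by move=> m n mn; exact: dirichlet_pow_decr.
Qed.
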